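(* Let $t\ge 3$ and let $g(z)=\sum_{j=1}^t e^{a_j\cdot z+\beta_j}$ be any $n$-variate exponential $t$-sum, with spectrum $S:=\{a_1,\ldots,a_t\}\subset\mathbb{R}^n$ (the $a_j$ pairwise distinct) and $\beta_j\in\mathbb{C}$. Let $\delta(g):=\min_{p\ne q}|a_p-a_q|$ and let $d$ be the dimension of the affine span of $S$. Then $d\le\min\{n,t-1\}$ and: (1) If $t=d+1$ then $\mathrm{Trop}(g)\subseteq\mathrm{Re}(Z(g))$. (2) If $t\ge d+1$ then (a) $\displaystyle\sup_{r\in\mathrm{Re}(Z(g))}\ \inf_{u\in\mathrm{Trop}(g)}|r-u|\le\frac{\log(t-1)}{\delta(g)}$, and (b) $\displaystyle\sup_{u\in\mathrm{Trop}(g)}\ \inf_{r\in\mathrm{Re}(Z(g))}|r-u|\le\frac{\sqrt{ed}\;t^2\left((\log 9)t-\log\frac{81}{2}\right)}{\delta(g)}$. (3) The bound from (2)(a) is optimal in the following sense: if $\delta>0$, $\varphi(z):=1+e^{\delta z_1}+\cdots+e^{\delta z_{t-1}}$ for $z\in\mathbb{C}^{t-1}$, and $r:=-\frac{\log(t-1)}{\delta}(1,\ldots,1)\in\mathbb{R}^{t-1}$, then $r\in\mathrm{Re}(Z(\varphi))$ and $\displaystyle\inf_{u\in\mathrm{Trop}(\varphi)}|r-u|=\frac{\log(t-1)}{\delta}$.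
   Context: For $a\in\mathbb{R}^n$, $z\in\mathbb{C}^n$, $a\cdot z=\sum_i a_iz_i$; $|\cdot|$ is the standard $\ell_2$-norm; in $\sqrt{ed}$, $e$ is the base of the natural logarithm $\log$. For an exponential sum $g$ in $n$ variables, $Z(g)\subset\mathbb{C}^n$ is its set of complex zeros, and $\mathrm{Re}(Z(g)):=\{(\mathrm{Re}(z_1),\ldots,\mathrm{Re}(z_n)):z\in Z(g)\}\subset\mathbb{R}^n$. The tropical variety is $\mathrm{Trop}(g):=\{(\mathrm{Re}(z_1),\ldots,\mathrm{Re}(z_n)): z\in\mathbb{C}^n,\ \max_j|e^{a_j\cdot z+\beta_j}|\text{ is attained at at least two distinct } j\}\subset\mathbb{R}^n$. The affine span of a set $S\subset\mathbb{R}^n$ is the smallest affine subspace of $\mathbb{R}^n$ containing $S$. *)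

(* Defs.v *)
From HB Require Import structures.
From mathcomp Require Import all_boot all_order all_algebra.
From mathcomp Require Import all_classical all_reals all_analysis.
From mathcomp Require Import complex.

Set Implicit Arguments.
Unset Strict Implicit.
Unset Printing Implicit Defensive.

Import Order.TTheory GRing.Theory Num.Theory.

Local Open Scope classical_set_scope.
Local Open Scope complex_scope.
Local Open Scope ring_scope.

Definition cexp (R : realType) (z : R[i]) : R[i] :=
  (expR (complex.Re z))%:C * (cos (complex.Im z) +i* sin (complex.Im z)).

Definition re_vec (R : realType) (n : nat) (z : 'rV[R[i]]_n) : 'rV[R]_n :=
  map_mx (@complex.Re R) z.

Definition cdot (R : realType) (n : nat) (a : 'rV[R]_n) (z : 'rV[R[i]]_n) :
    R[i] :=
  \sum_(i < n) (a 0 i)%:C * z 0 i.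

(* The norm provided by the library on ['rV[R]_n] is the sup norm. *)
Definition l2norm (R : realType) (n : nat) (v : 'rV[R]_n) : R :=
  Num.sqrt (\sum_(i < n) v 0 i ^+ 2).

Definition expterm (R : realType) (n t : nat) (a : 'I_t -> 'rV[R]_n)
    (beta : 'I_t -> R[i]) (z : 'rV[R[i]]_n) (j : 'I_t) : R[i] :=
  cexp (cdot (a j) z + beta j).

Definition expsum (R : realType) (n t : nat) (a : 'I_t -> 'rV[R]_n)
    (beta : 'I_t -> R[i]) (z : 'rV[R[i]]_n) : R[i] :=
  \sum_(j < t) expterm a beta z j.

Definition ReZ (R : realType) (n t : nat) (a : 'I_t -> 'rV[R]_n)
    (beta : 'I_t -> R[i]) : set 'rV[R]_n :=
  [set re_vec z | z in [set z | expsum a beta z = 0]].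

(* The moduli are compared in [R[i]], whose order extends that of [R]. *)
Definition max_attained_at (R : realType) (n t : nat) (a : 'I_t -> 'rV[R]_n)
    (beta : 'I_t -> R[i]) (z : 'rV[R[i]]_n) (j : 'I_t) : Prop :=
  forall l : 'I_t, `|expterm a beta z l| <= `|expterm a beta z j|.

Definition Trop (R : realType) (n t : nat) (a : 'I_t -> 'rV[R]_n)
    (beta : 'I_t -> R[i]) : set 'rV[R]_n :=
  [set re_vec z | z in [set z | exists j k : 'I_t,
    [/\ j != k, max_attained_at a beta z j & max_attained_at a beta z k]]].

(* The minimum is taken in [\bar R], where [+oo] is neutral; it is finite as
   soon as [t >= 2]. *)
Definition min_gap (R : realType) (n t : nat) (a : 'I_t -> 'rV[R]_n) : R :=
  fine (\big[Order.min/+oo%E]_(pq : 'I_t * 'I_t | pq.1 != pq.2)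
          (l2norm (a pq.1 - a pq.2))%:E).

Definition translate (R : realType) (n : nat) (p : 'rV[R]_n)
    (U : {vspace 'rV[R]_n}) : set 'rV[R]_n :=
  [set p + u | u in [set u | u \in U]].

Definition affine_subspace (R : realType) (n : nat) (A : set 'rV[R]_n) : Prop :=
  exists p U, A = translate p U.

Definition affine_span (R : realType) (n : nat) (S : set 'rV[R]_n) :
    set 'rV[R]_n :=
  smallest (@affine_subspace R n) S.

(* Takes the junk value [0] if [A] is not an affine subspace. *)
Definition affine_dim (R : realType) (n : nat) (A : set 'rV[R]_n) : nat :=
  xget 0%N [set d | exists p U, A = translate p U /\ \dim U = d].

(* Valued in [\bar R] so that the infimum over the empty set is [+oo]. *)
Definition dist_to (R : realType) (n : nat) (x : 'rV[R]_n) (B : set 'rV[R]_n) :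
    \bar R :=
  ereal_inf [set (l2norm (x - y))%:E | y in B].

Definition excess (R : realType) (n : nat) (A B : set 'rV[R]_n) : \bar R :=
  ereal_sup [set dist_to x B | x in A].

(* The data of [1 + e^(delta z_1) + ... + e^(delta z_(t-1))]: the exponent
   vector of index [0] is zero and that of index [i.+1] is [delta] times the
   [i]-th basis vector; see [expsum_phi]. *)
Definition phi_spectrum (R : realType) (t : nat) (delta : R) (j : 'I_t) :
    'rV[R]_t.-1 :=
  \row_(i < t.-1) (if j == i.+1 :> nat then delta else 0).

Definition phi_beta (R : realType) (t : nat) (j : 'I_t) : R[i] := 0.

Lemma cexp0 (R : realType) : cexp (0 : R[i]) = 1.
Proof. by rewrite /cexp /= expR0 cos0 sin0 mul1r. Qed.

Lemma expsum_phi (R : realType) (t : nat) (delta : R) (z : 'rV[R[i]]_t.-1) :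
  (0 < t)%N ->
  expsum (phi_spectrum delta) (@phi_beta R t) z =
  1 + \sum_(i < t.-1) cexp (delta%:C * z 0 i).
Proof.
case: t z => // t z _; rewrite /expsum big_ord_recl; congr (_ + _).
  rewrite /expterm /cdot /phi_beta addr0 big1 ?cexp0 // => i _.
  by rewrite mxE /= mul0r.
apply: eq_bigr => i _; rewrite /expterm /cdot /phi_beta addr0; congr cexp.
rewrite (bigD1 i) //= mxE /= eqxx big1 ?addr0 // => k ki.
by rewrite mxE /= /bump /= add1n eqSS -val_eqE eq_sym in ki *; rewrite (negbTE ki) mul0r.
Qed.

(* Main.v *)
Require Import Defs.
From HB Require Import structures.
From mathcomp Require Import all_boot all_order all_algebra.
From mathcomp Require Import all_classical all_reals all_analysis.
From mathcomp Require Import complex.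
From mathcomp Require Import ring lra.

(** The height of a term at [u] is the logarithm of its modulus over [u], an affine
    function of [u]; [Trop] is the locus where the largest height is attained twice.

    From zeros to tropical points ([zero_near_Trop]): at a zero the largest term is
    balanced by the [t - 1] others, so a second term is within [ln (t - 1)] of it in
    height, and moving along the difference of their exponents makes up for that
    amount within [ln (t - 1) / min_gap].

    From tropical points to zeros ([Trop_near_zero]): the claim is reduced to one
    variable by restriction to a line. Bang's lemma ([bang], the heart of his plank
    theorem) gives a vector [x] of length at most [t * (t - 1)] such that projecting
    the spectrum on [x] does not decrease its gap ([good_direction]). This loss is
    independent of the dimension, which leaves room in the final constant.

    In one variable ([usum_zero_near_kink]), let two terms tie at the origin. Among
    the points [0, 2 h, ..., 2 h (t - 1)] with [h = ln 3 / g], [g] the gap of the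
    exponents, some term leads at two points, hence on an interval of length at
    least [2 h]. At distance [h] from the ends of such an interval the leader
    outweighs the sum of all the other terms, by comparison with
    [2 * (1 / 3 + 1 / 9 + ...) = 1]. So there is a vertical line to the right of the
    origin where some term dominates, and one to the left where a term of smaller
    exponent does.

    A zero must lie in the strip between these lines ([usum_strip_zero]). This is
    the argument principle, made elementary: on a fine grid the argument of a
    nonvanishing function is carried by ratios of neighbouring values in the right
    half-plane, whose arguments add up exactly ([cargM]); the windings along the two
    sides of the rectangle would then agree up to its top and bottom. If the
    vertical sides have a common almost period of the terms ([almost_period]) as their
    length, then top and bottom cancel, whereas the dominant terms turn at different
    speeds on the two sides.

    When [t = d + 1] the spectrum is affinely independent, so that all phases can be
    chosen freely ([solve_phases]), and the moduli at a tropical point are the side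
    lengths of a closed polygon ([closed_polygon]). *)

Set Implicit Arguments.
Unset Strict Implicit.
Unset Printing Implicit Defensive.

Import Order.TTheory GRing.Theory Num.Theory.
Import numFieldNormedType.Exports.

Local Open Scope classical_set_scope.
Local Open Scope ring_scope.

Local Notation Re := complex.Re.
Local Notation Im := complex.Im.
Local Notation cmod := Normc.normc.

(** * Complex exponentials and moduli *)

Lemma cexpD (R : realType) (z w : R[i]) : cexp (z + w) = cexp z * cexp w.
Proof.
case: z w => [a b] [c d]; rewrite /cexp /= expRD cosD sinD.
by simpc; congr (_ +i* _)%C; ring.
Qed.

Lemma cmod_cexp (R : realType) (z : R[i]) : cmod (cexp z) = expR (Re z).
Proof.
rewrite /cexp Normc.normcM /= cos2Dsin2 sqrtr1 mulr1 expr0n /= addr0.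
by rewrite sqrtr_sqr ger0_norm ?expR_ge0.
Qed.

Lemma cexp_real (R : realType) (x : R) : cexp x%:C%C = (expR x)%:C%C.
Proof. by rewrite /cexp /= cos0 sin0 mulr1. Qed.

Lemma normr_cmod (R : realType) (z : R[i]) : `|z| = (cmod z)%:C%C.
Proof. by case: z. Qed.

Lemma cmod_ge0 (R : realType) (z : R[i]) : 0 <= cmod z.
Proof. by case: z => a b; rewrite sqrtr_ge0. Qed.

Lemma cmod_gt0 (R : realType) (z : R[i]) : (0 < cmod z) = (z != 0).
Proof.
rewrite lt_neqAle cmod_ge0 andbT eq_sym; congr negb.
by apply/eqP/eqP => [/Normc.eq0_normc|->]; rewrite ?Normc.normc0.
Qed.

Lemma ler_cmod_sum (R : realType) (I : finType) (P : pred I) (F : I -> R[i]) :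
  cmod (\sum_(i | P i) F i) <= \sum_(i | P i) cmod (F i).
Proof.
apply: (big_ind2 (fun x y => cmod x <= y)) => //; first by rewrite Normc.normc0.
move=> x1 x2 y1 y2 h1 h2; apply: le_trans (le_normcD _ _) _; exact: lerD.
Qed.

Lemma Re_ge_Ncmod (R : realType) (z : R[i]) : - cmod z <= Re z.
Proof.
case: z => a b /=; rewrite lerNl; apply: le_trans (ler_norm _) _.
by rewrite normrN -sqrtr_sqr ler_wsqrtr // lerDl sqr_ge0.
Qed.

Lemma Re_div_gt0 (R : realType) (p q : R[i]) :
  cmod (q - p) < cmod p -> 0 < Re (q / p).
Proof.
move=> h; have p0 : p != 0.
  by rewrite -cmod_gt0; apply: le_lt_trans h; exact: cmod_ge0.
have -> : q / p = 1 + (q - p) / p by field.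
have h1 : cmod ((q - p) / p) < 1.
  by rewrite Normc.normcM Normc.normcV ltr_pdivrMr ?cmod_gt0 // mul1r.
have := Re_ge_Ncmod ((q - p) / p).
by rewrite raddfD /=; set u := Re _; lra.
Qed.

(** * The argument in the right half-plane *)

Definition carg (R : realType) (w : R[i]) : R := atan (Im w / Re w).

Lemma carg_bound (R : realType) (w : R[i]) : - (pi / 2) < carg w < pi / 2.
Proof. by rewrite atan_gtNpi2 atan_ltpi2. Qed.

Lemma carg_polar (R : realType) (w : R[i]) : 0 < Re w ->
  exists2 r, 0 < r & Re w = r * cos (carg w) /\ Im w = r * sin (carg w).
Proof.
move=> w0; have c0 : 0 < cos (carg w) by apply: cos_gt0_pihalf; exact: carg_bound.
exists (Re w / cos (carg w)); first by rewrite divr_gt0.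
split; first by rewrite divfK // gt_eqF.
have -> : Re w / cos (carg w) * sin (carg w) = Re w * tan (carg w).
  by rewrite /tan mulrAC mulrA.
by rewrite atanK mulrC divfK // gt_eqF.
Qed.

Lemma carg_cexp (R : realType) (x y : R) :
  - (pi / 2) < y < pi / 2 -> carg (cexp (x +i* y)%C) = y.
Proof.
move=> hy; rewrite /carg /cexp /=; have c0 := cos_gt0_pihalf hy.
rewrite !mul0r subr0 addr0 -[RHS]tanK ?in_itv //; congr atan.
by rewrite /tan; field; rewrite gt_eqF //= gt_eqF // expR_gt0.
Qed.

Lemma angle_eq0 (R : realType) (D : R) :
  - (2 * pi) < D < 2 * pi -> sin D = 0 -> 0 < cos D -> D = 0.
Proof.
move=> /andP[D1 D2]; have DE : D = (D / 2) *+ 2 by rewrite -mulr_natr divfK.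
rewrite {1 2}DE sin_mulr2n cos_mulr2n; set x := D / 2.
have x1 : - pi < x by rewrite /x; lra.
have x2 : x < pi by rewrite /x; lra.
move=> /eqP; rewrite mulrn_eq0 /= mulf_eq0 => /orP[/eqP ->|/eqP sx].
  by rewrite expr0n mul0rn /= sub0r ltr0N1.
move=> _; suff x0 : x = 0 by rewrite DE -/x x0 mul0rn.
have [xlt|xgt|//] := ltgtP x 0.
  suff : 0 < sin (- x) by rewrite sinN sx oppr0 ltxx.
  by apply: sin_gt0_pi; rewrite oppr_gt0 xlt /= ltrNl.
suff : 0 < sin x by rewrite sx ltxx.
by apply: sin_gt0_pi; rewrite xgt x2.
Qed.

(** Additivity of the argument modulo [2 pi] becomes an exact identity here: four
    angles of absolute value less than [pi / 2] leave no room for a nonzero multiple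
    of [2 pi]. *)
Lemma cargM (R : realType) (w1 w2 w3 w4 : R[i]) :
  0 < Re w1 -> 0 < Re w2 -> 0 < Re w3 -> 0 < Re w4 ->
  w1 * w2 = w3 * w4 -> carg w1 + carg w2 = carg w3 + carg w4.
Proof.
move=> /carg_polar[r1 r10 [e1 f1]] /carg_polar[r2 r20 [e2 f2]].
move=> /carg_polar[r3 r30 [e3 f3]] /carg_polar[r4 r40 [e4 f4]] E.
have := carg_bound w1; have := carg_bound w2; have := carg_bound w3.
have := carg_bound w4.
move: (carg w1) (carg w2) (carg w3) (carg w4) e1 f1 e2 f2 e3 f3 e4 f4.
move=> a b c d e1 f1 e2 f2 e3 f3 e4 f4 /andP[d1 d2] /andP[c1 c2] /andP[b1 b2].
move=> /andP[a1 a2].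
have ER : Re (w1 * w2) = Re (w3 * w4) by rewrite E.
have EI : Im (w1 * w2) = Im (w3 * w4) by rewrite E.
have RM (u v : R[i]) : Re (u * v) = Re u * Re v - Im u * Im v.
  by case: u; case: v.
have IM (u v : R[i]) : Im (u * v) = Re u * Im v + Im u * Re v.
  by case: u; case: v.
rewrite !RM e1 e2 e3 e4 f1 f2 f3 f4 in ER.
rewrite !IM e1 e2 e3 e4 f1 f2 f3 f4 in EI.
have {}ER : r1 * r2 * cos (a + b) = r3 * r4 * cos (c + d).
  by rewrite !cosD; lra.
have {}EI : r1 * r2 * sin (a + b) = r3 * r4 * sin (c + d).
  by rewrite !sinD; lra.
have r120 : 0 < r1 * r2 by rewrite mulr_gt0.
have r340 : 0 < r3 * r4 by rewrite mulr_gt0.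
apply/eqP; rewrite -subr_eq0; apply/eqP; apply: angle_eq0; first by apply/andP; lra.
  apply: (mulfI (lt0r_neq0 r120)); rewrite mulr0 sinB mulrBr !mulrA EI ER; ring.
rewrite -(pmulr_rgt0 _ r120) cosB mulrDr !mulrA ER EI.
have -> : r3 * r4 * cos (c + d) * cos (c + d) + r3 * r4 * sin (c + d) * sin (c + d) =
  r3 * r4 * (cos (c + d) ^+ 2 + sin (c + d) ^+ 2) by ring.
by rewrite cos2Dsin2 mulr1.
Qed.

(** * Discrete winding *)

(** Each step contributes the argument of a ratio. This is a change of argument
    only for ratios in the right half-plane, a condition that appears as a hypothesis
    wherever it matters and that a fine mesh ensures. *)
Definition turn (R : realType) (x : nat -> R[i]) (M : nat) : R :=
  \sum_(0 <= m < M) carg (x m.+1 / x m).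

(** Two discrete paths that stay within a right angle of one another turn
    equally, up to the discrepancy at their endpoints. This plays the role of the
    homotopy invariance of the winding number, and uses only [cargM] on each
    quadrilateral. *)
Lemma turn_close (R : realType) (x y : nat -> R[i]) (M : nat) :
  (forall m, (m < M)%N -> 0 < Re (x m.+1 / x m)) ->
  (forall m, (m < M)%N -> 0 < Re (y m.+1 / y m)) ->
  (forall m, (m <= M)%N -> 0 < Re (y m / x m)) ->
  turn y M - turn x M = carg (y M / x M) - carg (y 0%N / x 0%N).
Proof.
move=> hx hy hxy.
have nz m : (m <= M)%N -> x m != 0 /\ y m != 0.
  move=> /hxy h; split; apply/eqP => e; move: h; rewrite e.
    by rewrite invr0 mulr0 ltxx.
  by rewrite mul0r ltxx.
rewrite /turn -sumrB -(telescope_sumr (fun m => carg (y m / x m))) //.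
apply: eq_big_nat => m /andP[_ mM].
have [xm ym] := nz _ (ltnW mM); have [xm1 ym1] := nz _ mM.
suff : carg (y m.+1 / y m) + carg (y m / x m) =
       carg (y m.+1 / x m.+1) + carg (x m.+1 / x m) by lra.
apply: cargM; rewrite ?hx ?hy ?hxy //; first exact: ltnW.
by field; rewrite xm ym xm1.
Qed.

Lemma turn_cexp (R : realType) (c z w : R[i]) (M : nat) : c != 0 ->
  - (pi / 2) < Im w < pi / 2 ->
  turn (fun m => c * cexp (z + m%:R * w)) M = M%:R * Im w /\
  (forall m, 0 < Re (c * cexp (z + m.+1%:R * w) / (c * cexp (z + m%:R * w)))).
Proof.
move=> c0 hw.
have E m : c * cexp (z + m.+1%:R * w) / (c * cexp (z + m%:R * w)) = cexp w.
  have -> : z + m.+1%:R * w = (z + m%:R * w) + w by rewrite -natr1; ring.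
  rewrite cexpD; field; rewrite c0 /= -cmod_gt0 cmod_cexp expR_gt0 //.
split=> [|m].
  rewrite /turn (eq_bigr (fun=> Im w)) => [|m _].
    by rewrite sumr_const_nat subn0 mulr_natl.
  by rewrite E; case: (w) hw => a b hb; exact: carg_cexp.
rewrite E; case: (w) hw => a b hb; rewrite /cexp /= mul0r subr0.
by rewrite mulr_gt0 ?expR_gt0 ?cos_gt0_pihalf.
Qed.

(** * Almost periods *)

Lemma near0_lt (R : realType) (f : R -> R) (e : R) :
  {for 0, continuous f} -> f 0 = 0 -> 0 < e ->
  exists2 eta : R, 0 < eta & forall x, `|x| < eta -> `|f x| < e.
Proof.
move=> cf f0 e0; have /cvgrPdist_lt /(_ _ e0) := cf.
rewrite f0 => /nbhs_ballP[eta /= eta0 h]; exists eta => // x hx.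
have /h /= : ball (0 : R) eta x by rewrite -ball_normE /= sub0r normrN.
by rewrite sub0r normrN.
Qed.

Lemma cexp_near1 (R : realType) (e : R) : 0 < e ->
  exists2 eta : R, 0 < eta & forall x, `|x| < eta ->
    cmod (cexp (x +i* 0)%C - 1) < e /\ cmod (cexp (0 +i* x)%C - 1) < e.
Proof.
move=> e0.
have [h1 h10 H1] : exists2 eta : R, 0 < eta & forall x : R, `|x| < eta ->
    `|expR x - 1| < e.
  apply: near0_lt => //; last by rewrite expR0 subrr.
  by apply: continuousB; [exact: continuous_expR|exact: cst_continuous].
have [h2 h20 H2] : exists2 eta : R, 0 < eta & forall x : R, `|x| < eta ->
    `|2 - 2 * cos x| < e ^+ 2.
  apply: near0_lt; rewrite ?exprn_gt0 ?cos0 ?mulr1 ?subrr //.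
  apply: continuousB; first exact: cst_continuous.
  by apply: continuousM; [exact: cst_continuous|exact: continuous_cos].
exists (Order.min h1 h2); first by rewrite lt_min h10.
move=> x; rewrite lt_min => /andP[/H1 a /H2 b]; split.
  have -> : cexp (x +i* 0)%C - 1 = ((expR x - 1)%:C)%C.
    by rewrite -[(x +i* 0)%C]/(x%:C)%C cexp_real rmorphB rmorph1.
  by rewrite /= expr0n /= addr0 sqrtr_sqr.
rewrite /cexp /= expR0 !mul1r !mul0r subr0 addr0 subr0.
have -> : (cos x - 1) ^+ 2 + sin x ^+ 2 = 2 - 2 * cos x.
  by have := cos2Dsin2 x; lra.
rewrite -(ger0_norm (ltW e0)) -[ltRHS]sqrtr_sqr ltr_sqrt ?exprn_gt0 //.
by apply: le_lt_trans b; exact: ler_norm.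
Qed.

Lemma cexp_period (R : realType) (x : R) (k : int) :
  cexp (0 +i* (x + 2 * pi * k%:~R))%C = cexp (0 +i* x)%C.
Proof.
have P (n : nat) (y : R) : cexp (0 +i* (y + 2 * pi * n%:R))%C = cexp (0 +i* y)%C.
  rewrite /cexp /=; have -> : y + 2 * pi * n%:R = y + (pi *+ 2) *+ n.
    by rewrite -(mulr_natr (pi *+ 2)) -(mulr_natl pi).
  by rewrite (periodicn (@cosD2pi R)) (periodicn (@sinD2pi R)).
case: k => n; first exact: P.
rewrite -[in RHS](subrK (2 * pi * n.+1%:R) x) P.
by rewrite NegzE mulrNz mulrN.
Qed.

(** Dirichlet's pigeonhole argument, in a form that gives arbitrarily long common
    almost periods: cut the torus into [K ^ t] boxes and follow the multiples of
    [H0]. *)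
Lemma almost_period (R : realType) (t : nat) (al : 'I_t -> R) (H0 e : R) :
  0 < H0 -> 0 < e ->
  exists2 H, H0 <= H &
    forall l, cmod (cexp (0 +i* (al l * H))%C - 1) < e.
Proof.
move=> H00 e0; have [eta eta0 near1] := cexp_near1 e0.
pose K := (Num.truncn (2 * pi / eta)).+1.
have KE : 2 * pi / eta < K%:R by exact: truncnS_gt.
have K0 : 0 < K%:R :> R by rewrite ltr0n.
pose x l : R := al l * H0 / (2 * pi).
pose fr l (n : nat) : R := x l * n%:R - (Num.floor (x l * n%:R))%:~R.
have fr01 l n : 0 <= fr l n < 1.
  have /andP[a b] := floor_itv (x l * n%:R); rewrite intrD in b.
  by rewrite /fr subr_ge0 a /= ltrBlDr addrC.
have boxP l n : (Num.truncn (K%:R * fr l n) < K)%N.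
  have /andP[a b] := fr01 l n.
  by rewrite truncn_lt_nat ?mulr_ge0 // -[ltRHS]mulr1 ltr_pM2l.
pose box (n : 'I_(K ^ t).+1) : {ffun 'I_t -> 'I_K} := [ffun l => Ordinal (boxP l n)].
have [n1 [n2 [n12 boxE]]] : exists n1 n2 : 'I_(K ^ t).+1,
    (n1 < n2)%N /\ box n1 = box n2.
  apply: contrapT => hN; have : injective box.
    move=> a b ab; apply/val_inj => /=; case: (ltngtP a b) => // h; exfalso; apply: hN.
      by exists a, b.
    by exists b, a.
  by move=> /leq_card; rewrite card_ffun !card_ord ltnn.
exists ((n2 - n1)%:R * H0) => [|l].
  by rewrite ler_peMl ?(ltW H00) // ler1n subn_gt0.
have E : (Num.truncn (K%:R * fr l n1)) = Num.truncn (K%:R * fr l n2).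
  by have /ffunP/(_ l) := boxE; rewrite !ffunE => /(congr1 val).
set k := Num.floor (x l * n2%:R) - Num.floor (x l * n1%:R).
have -> : al l * ((n2 - n1)%:R * H0) =
    2 * pi * (fr l n2 - fr l n1) + 2 * pi * k%:~R.
  rewrite /fr /k intrB natrB 1?ltnW // /x.
  by move: pi (lt0r_neq0 (pi_gt0 R)) => p p0; field.
rewrite cexp_period; apply: (near1 _ _).2.
have /andP[p1 _] := fr01 l n1; have /andP[p2 _] := fr01 l n2.
have /andP[a1 b1] := truncn_itv (mulr_ge0 (ltW K0) p1).
have /andP[a2 b2] := truncn_itv (mulr_ge0 (ltW K0) p2).
rewrite -E -natr1 in a2 b2; rewrite -natr1 in b1.
have D1 : `|K%:R * (fr l n2 - fr l n1)| < 1.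
  by rewrite ltr_norml mulrBr; apply/andP; split; lra.
rewrite normrM (gtr0_norm K0) in D1.
rewrite normrM gtr0_norm ?mulr_gt0 ?pi_gt0 //.
have D2 : 2 * pi < eta * K%:R by rewrite [ltRHS]mulrC -ltr_pdivrMr.
rewrite -(ltr_pM2r K0); apply: le_lt_trans D2.
by rewrite -mulrA ler_piMr ?mulr_ge0 ?pi_ge0 // mulrC ltW.
Qed.

(** * Zeros of univariate exponential sums in a strip *)

Definition usum (R : realType) (t : nat) (c : 'I_t -> R[i]) (al : 'I_t -> R)
  (s : R[i]) : R[i] := \sum_l c l * cexp ((al l)%:C%C * s).

Lemma cmod_term (R : realType) (c : R[i]) (x : R) (s : R[i]) :
  cmod (c * cexp (x%:C%C * s)) = cmod c * expR (x * Re s).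
Proof. by rewrite Normc.normcM cmod_cexp; case: s => a b /=; rewrite mul0r subr0. Qed.

(** The sum of the endpoint values replaces their maximum, which avoids a case
    distinction on the sign of the exponent later on. *)
Lemma expR_between (R : realType) (x s1 s2 s : R) : s1 <= s <= s2 ->
  expR (x * s) <= expR (x * s1) + expR (x * s2).
Proof.
move=> /andP[h1 h2]; have [x0|x0] := leP 0 x.
  apply: (@le_trans _ _ (expR (x * s2))); last by rewrite lerDr expR_ge0.
  by rewrite ler_expR ler_wpM2l.
apply: (@le_trans _ _ (expR (x * s1))); last by rewrite lerDl expR_ge0.
by rewrite ler_expR ler_wnM2l // ltW.
Qed.

Lemma usum_step (R : realType) (t : nat) (c : 'I_t -> R[i]) (al : 'I_t -> R)
    (s1 s2 e : R) (s h : R[i]) : s1 <= Re s <= s2 ->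
  (forall l, cmod (cexp ((al l)%:C%C * h) - 1) <= e) ->
  cmod (usum c al (s + h) - usum c al s) <=
  e * \sum_l cmod (c l) * (expR (al l * s1) + expR (al l * s2)).
Proof.
move=> hs he; rewrite /usum -sumrB mulr_sumr.
apply: le_trans (ler_cmod_sum _ _) _; apply: ler_sum => l _.
have -> : c l * cexp ((al l)%:C%C * (s + h)) - c l * cexp ((al l)%:C%C * s) =
   (cexp ((al l)%:C%C * h) - 1) * (c l * cexp ((al l)%:C%C * s)).
  by rewrite mulrDr cexpD; ring.
rewrite Normc.normcM cmod_term; apply: ler_pM; rewrite ?cmod_ge0 //.
  by rewrite mulr_ge0 ?cmod_ge0 ?expR_ge0.
by rewrite ler_wpM2l ?cmod_ge0 ?expR_between.
Qed.

Lemma continuous_Re_cexp (R : realType) (c : R[i]) (x : R) :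
  continuous (fun p : R * R => Re (c * cexp (x%:C%C * (p.1 +i* p.2)%C))).
Proof.
case: c => a b.
have -> : (fun p : R * R => Re ((a +i* b)%C * cexp (x%:C%C * (p.1 +i* p.2)%C))) =
  (fun p : R * R => expR (x * p.1) * (a * cos (x * p.2) - b * sin (x * p.2))).
  by apply/funext => p /=; rewrite /cexp; simpc => /=; ring.
have c1 : continuous (fun p : R * R => x * p.1).
  by move=> p; apply: cvgM; [exact: cvg_cst|exact: cvg_fst].
have c2 : continuous (fun p : R * R => x * p.2).
  by move=> p; apply: cvgM; [exact: cvg_cst|exact: cvg_snd].
move=> p; apply: cvgM.
  by apply: (continuous_comp (c1 p)); exact: continuous_expR.
apply: cvgB; (apply: cvgM; first exact: cvg_cst).
  by apply: (continuous_comp (c2 p)); exact: continuous_cos.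
by apply: (continuous_comp (c2 p)); exact: continuous_sin.
Qed.

Lemma continuous_Re_usum (R : realType) (t : nat) (c : 'I_t -> R[i])
    (al : 'I_t -> R) :
  continuous (fun p : R * R => Re (usum c al (p.1 +i* p.2)%C)).
Proof.
have -> : (fun p : R * R => Re (usum c al (p.1 +i* p.2)%C)) =
  (fun p => \sum_l Re (c l * cexp ((al l)%:C%C * (p.1 +i* p.2)%C))).
  by apply/funext => p; rewrite /usum raddf_sum.
apply: continuous_big => [|l _]; first exact: add_continuous.
exact: continuous_Re_cexp.
Qed.

Lemma usum_box_min (R : realType) (t : nat) (c : 'I_t -> R[i])
    (al : 'I_t -> R) (s1 s2 H : R) : s1 <= s2 -> 0 <= H ->
  (forall s, s1 <= Re s <= s2 -> usum c al s != 0) ->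
  exists2 e : R, 0 < e & forall x y, s1 <= x <= s2 -> 0 <= y <= H ->
    e <= cmod (usum c al (x +i* y)%C).
Proof.
move=> s12 H0 nz.
(* the imaginary part is the real part of [- 'i] times the sum *)
pose g (p : R * R) := Re (usum c al (p.1 +i* p.2)%C) ^+ 2 +
   Re (usum (fun l => (0 +i* (-1))%C * c l) al (p.1 +i* p.2)%C) ^+ 2.
have cg : continuous g.
  by move=> p; apply: cvgD; rewrite /=; (apply: cvgM; exact: continuous_Re_usum).
have gE p : g p = cmod (usum c al (p.1 +i* p.2)%C) ^+ 2.
  rewrite /g; have -> : usum (fun l => (0 +i* (-1))%C * c l) al (p.1 +i* p.2)%C =
      (0 +i* (-1))%C * usum c al (p.1 +i* p.2)%C.
    by rewrite /usum mulr_sumr; apply: eq_bigr => l _; rewrite mulrA.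
  case: (usum c al _) => a b /=; rewrite sqr_sqrtr ?addr_ge0 ?sqr_ge0 //; ring.
have [||[x0 y0] pin pmin] :=
  @compact_EVT_min _ R g (`[s1, s2] `*` `[0, H]) _
    (compact_setX (@segment_compact _ _ _) (@segment_compact _ _ _)).
- by exists (s1, 0); split => /=; rewrite in_itv /= lexx.
- exact: continuous_subspaceT.
have nz0 : usum c al (x0 +i* y0)%C != 0.
  by apply: nz; move: pin; rewrite inE => -[] /=; rewrite !in_itv.
exists (cmod (usum c al (x0 +i* y0)%C)); first by rewrite cmod_gt0.
move=> x y hx hy; rewrite -ler_sqr ?nnegrE ?cmod_ge0 //.
rewrite -(gE (x0, y0)) -(gE (x, y)); apply: pmin.
by rewrite inE; split; rewrite /= in_itv.
Qed.

(** Where one term outweighs the sum of the others, the argument of the sum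
    follows that of the term, which turns at constant speed. *)
Lemma turn_dominated (R : realType) (t : nat) (c : 'I_t -> R[i])
    (al : 'I_t -> R) (k : 'I_t) (s h : R) (M : nat) :
  \sum_(l | l != k) cmod (c l) * expR (al l * s) < cmod (c k) * expR (al k * s) ->
  - (pi / 2) < al k * h < pi / 2 ->
  (forall m, (m < M)%N -> 0 < Re (usum c al (s +i* (m.+1%:R * h))%C /
                                  usum c al (s +i* (m%:R * h))%C)) ->
  `|turn (fun m => usum c al (s +i* (m%:R * h))%C) M - M%:R * (al k * h)| < pi.
Proof.
move=> dom hk step.
have c0 : c k != 0.
  apply: contraTneq dom => ->; rewrite Normc.normc0 mul0r -leNgt.
  by apply: sumr_ge0 => l _; rewrite mulr_ge0 ?cmod_ge0 ?expR_ge0.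
pose E (m : nat) := c k * cexp ((al k)%:C%C * s%:C%C + m%:R * (0 +i* (al k * h))%C).
have EE m : E m = c k * cexp ((al k)%:C%C * (s +i* (m%:R * h))%C).
  rewrite /E; congr (_ * cexp _); rewrite -[m%:R](rmorph_nat (real_complex R)) /=.
  by simpc; congr (_ +i* _)%C; ring.
have [TE ratE] := @turn_cexp R (c k) ((al k)%:C%C * s%:C%C)
  (0 +i* (al k * h))%C M c0 hk.
rewrite -/E /= in TE; rewrite -TE.
rewrite (@turn_close _ E _ M (fun m _ => ratE m) step); last first.
  move=> m _; apply: Re_div_gt0; rewrite EE /usum (bigD1 k) //=.
  have addNKl (u v : R[i]) : u + v - u = v by ring.
  rewrite addNKl.
  rewrite cmod_term /=; apply: le_lt_trans dom; apply: le_trans (ler_cmod_sum _ _) _.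
  by apply: ler_sum => l _; rewrite cmod_term.
set w1 := (X in carg X - _); set w2 := (X in _ - carg X).
have /andP[a1 a2] := carg_bound w1; have /andP[b1 b2] := carg_bound w2.
by rewrite ltr_norml; apply/andP; split; lra.
Qed.

(** Existence of zeros without the argument principle. If the sum had no zero in
    the strip, the discrete winding along the two vertical sides of a tall
    rectangle would agree up to the difference between its top and bottom sides.
    Taking the height to be an almost period makes those two sides nearly
    identical, so the windings agree up to a constant; but the left one grows like
    [al j * H] and the right one like [al k * H]. *)
Theorem usum_strip_zero (R : realType) (t : nat) (c : 'I_t -> R[i])
    (al : 'I_t -> R) (s1 s2 : R) (j k : 'I_t) :
  s1 <= s2 -> al j < al k ->
  \sum_(l | l != j) cmod (c l) * expR (al l * s1) < cmod (c j) * expR (al j * s1) ->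
  \sum_(l | l != k) cmod (c l) * expR (al l * s2) < cmod (c k) * expR (al k * s2) ->
  exists2 s, s1 <= Re s <= s2 & usum c al s = 0.
Proof.
move=> s12 ajk dom1 dom2; apply: contrapT => hN.
have nz s : s1 <= Re s <= s2 -> usum c al s != 0.
  by move=> hs; apply/eqP => e; apply: hN; exists s.
have pi0 := pi_gt0 R.
pose B := \sum_l cmod (c l) * (expR (al l * s1) + expR (al l * s2)).
have B0 : 0 <= B.
  by apply: sumr_ge0 => l _; rewrite mulr_ge0 ?cmod_ge0 ?addr_ge0 ?expR_ge0.
have B1 : 0 < B + 1 by lra.
have small (e : R) : 0 < e -> e / (B + 1) * B < e.
  by move=> e0; rewrite mulrAC ltr_pdivrMr // ltr_pM2l //; lra.
have [e0 e00 min0] := usum_box_min s12 (lexx 0) nz.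
(* [3 pi] bounds the sum of three errors: one for top against bottom, and one for
   each side against its dominant term *)
have [H HH0 perH] : exists2 H, 3 * pi / (al k - al j) <= H &
    forall l, cmod (cexp (0 +i* (al l * H))%C - 1) < e0 / (B + 1).
  by apply: almost_period; rewrite divr_gt0 ?mulr_gt0 ?subr_gt0.
have H0 : 0 < H.
  by apply: lt_le_trans HH0; rewrite divr_gt0 ?mulr_gt0 ?subr_gt0.
have [e1 e10 min1] := usum_box_min s12 (ltW H0) nz.
have [eta eta0 near1] := cexp_near1 (divr_gt0 e10 B1).
pose A := \sum_l `|al l| + 1.
have A0 : 0 < A by rewrite ltr_wpDl // sumr_ge0.
have alA l : `|al l| <= A.
  by rewrite /A (bigD1 l) //= -addrA lerDl addr_ge0 // sumr_ge0.
pose m0 := Order.min eta (pi / 2).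
have m00 : 0 < m0 by rewrite lt_min eta0 divr_gt0.
pose N := (Num.truncn ((s2 - s1 + H) * A / m0)).+1.
have N0 : 0 < N%:R :> R by rewrite ltr0n.
have NE : (s2 - s1 + H) * A < m0 * N%:R.
  by rewrite [ltRHS]mulrC -ltr_pdivrMr //; exact: truncnS_gt.
have fine_mesh l x : 0 <= x <= s2 - s1 + H -> `|al l * (x / N%:R)| < m0.
  move=> /andP[x0 x1]; rewrite !normrM normfV (gtr0_norm N0) (ger0_norm x0) mulrA.
  rewrite ltr_pdivrMr //; apply: le_lt_trans NE; rewrite mulrC.
  exact: ler_pM.
pose dx := (s2 - s1) / N%:R; pose dy := H / N%:R.
have meshx l : `|al l * dx| < m0 by apply: fine_mesh; lra.
have meshy l : `|al l * dy| < m0 by apply: fine_mesh; lra.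
have dx0 : 0 <= dx by rewrite divr_ge0 // subr_ge0.
have dy0 : 0 <= dy by rewrite divr_ge0 // ltW.
have Ndx : N%:R * dx = s2 - s1 by rewrite mulrC divfK ?gt_eqF.
have Ndy : N%:R * dy = H by rewrite mulrC divfK ?gt_eqF.
have inx (i : nat) : (i <= N)%N -> s1 <= s1 + i%:R * dx <= s2.
  move=> iN; rewrite lerDl mulr_ge0 //= -lerBrDl -Ndx.
  by rewrite ler_wpM2r // ler_nat.
have iny (m : nat) : (m <= N)%N -> 0 <= m%:R * dy <= H.
  by move=> mN; rewrite mulr_ge0 //= -Ndy ler_wpM2r // ler_nat.
pose G (i m : nat) := usum c al ((s1 + i%:R * dx) +i* (m%:R * dy))%C.
have minG i m : (i <= N)%N -> (m <= N)%N -> e1 <= cmod (G i m).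
  by move=> iN mN; apply: min1; rewrite ?inx ?iny.
have mulCi (x y : R) : x%:C%C * (0 +i* y)%C = (0 +i* (x * y))%C by simpc.
have mulCr (x y : R) : x%:C%C * (y +i* 0)%C = ((x * y) +i* 0)%C by simpc.
have stepx i m : (i < N)%N -> (m <= N)%N -> 0 < Re (G i.+1 m / G i m).
  move=> iN mN; apply: Re_div_gt0; apply: lt_le_trans (minG _ _ (ltnW iN) mN).
  apply: le_lt_trans (small _ e10); rewrite /G.
  have -> : ((s1 + i.+1%:R * dx) +i* (m%:R * dy))%C =
      (((s1 + i%:R * dx) +i* (m%:R * dy)) + (dx +i* 0))%C.
    by rewrite -natr1; simpc; congr (_ +i* _)%C; ring.
  apply: usum_step => [|l]; first exact: inx (ltnW iN).
  rewrite mulCr; apply: ltW; apply: (near1 _ _).1.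
  by apply: lt_le_trans (meshx l) _; rewrite ge_min lexx.
have stepy i m : (i <= N)%N -> (m < N)%N -> 0 < Re (G i m.+1 / G i m).
  move=> iN mN; apply: Re_div_gt0; apply: lt_le_trans (minG _ _ iN (ltnW mN)).
  apply: le_lt_trans (small _ e10); rewrite /G.
  have -> : ((s1 + i%:R * dx) +i* (m.+1%:R * dy))%C =
      (((s1 + i%:R * dx) +i* (m%:R * dy)) + (0 +i* dy))%C.
    by rewrite -natr1; simpc; congr (_ +i* _)%C; ring.
  apply: usum_step => [|l]; first exact: inx iN.
  rewrite mulCi; apply: ltW; apply: (near1 _ _).2.
  by apply: lt_le_trans (meshy l) _; rewrite ge_min lexx.
(* the top side of the rectangle follows its bottom side *)
have topbot i : (i <= N)%N -> 0 < Re (G i N / G i 0%N).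
  move=> iN; apply: Re_div_gt0; rewrite /G mul0r Ndy.
  apply: lt_le_trans (min0 _ _ (inx _ iN) _); last by rewrite lexx.
  apply: le_lt_trans (small _ e00).
  have -> : ((s1 + i%:R * dx) +i* H)%C = (((s1 + i%:R * dx) +i* 0) + (0 +i* H))%C.
    by simpc.
  apply: usum_step => [|l]; first exact: inx iN.
  by rewrite mulCi; apply: ltW; apply: perH.
pose V i := turn (G i) N.
have sides : V N - V 0%N = turn (G ^~ N) N - turn (G ^~ 0%N) N.
  rewrite -(telescope_sumr V) // /turn -sumrB; apply: eq_big_nat => i /andP[_ iN].
  rewrite /V (@turn_close _ (G i) (G i.+1)) // => [m mN|m mN|m mN].
  - by apply: stepy => //; exact: ltnW.
  - exact: stepy.
  - exact: stepx.
have := @turn_close _ (G ^~ 0%N) (G ^~ N) N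
  (fun i iN => stepx i 0%N iN (leq0n _)) (fun i iN => stepx i N iN (leqnn _)) topbot.
rewrite -sides.
set w1 := (X in carg X - _); set w2 := (X in _ - carg X) => Vdiff.
have /andP[a1 a2] := carg_bound w1; have /andP[b1 b2] := carg_bound w2.
have angle l : - (pi / 2) < al l * dy < pi / 2.
  rewrite -ltr_norml; apply: lt_le_trans (meshy l) _.
  by rewrite ge_min lexx orbT.
have sN : s1 + N%:R * dx = s2 by rewrite Ndx addrC subrK.
have VN : `|V N - al k * H| < pi.
  rewrite -Ndy mulrCA /V /G sN.
  apply: turn_dominated => // m mN.
  by have := stepy N m (leqnn _) mN; rewrite /G sN.
have V0 : `|V 0%N - al j * H| < pi.
  rewrite -Ndy mulrCA /V /G mul0r addr0.
  apply: turn_dominated => // m mN.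
  by have := stepy 0%N m (leq0n _) mN; rewrite /G mul0r addr0.
move: VN V0; rewrite !ltr_norml => /andP[c1 c2] /andP[d1 d2].
have : 3 * pi <= (al k - al j) * H by rewrite [leRHS]mulrC -ler_pdivrMr ?subr_gt0.
rewrite mulrBl; lra.
Qed.

(** * Zeros near the kinks of a univariate sum *)

Lemma sum_pow3_lt (R : realType) (s : seq nat) :
  uniq s -> all (leq 1) s -> \sum_(m <- s) (3%:R^-1 : R) ^+ m < 2^-1.
Proof.
move=> us /allP s1; pose M := (\max_(m <- s) m)%N.
have sM m : m \in s -> (m <= M)%N by move=> ms; rewrite /M (big_rem _ ms) leq_maxl.
have /(perm_big _) -> : perm_eq s [seq m <- iota 1 M | m \in s].
  apply: uniq_perm => // [|m]; first by rewrite filter_uniq ?iota_uniq.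
  rewrite mem_filter mem_iota; case ms: (m \in s) => //=.
  by rewrite s1 // add1n ltnS sM.
rewrite big_filter.
have geo n : \sum_(m <- iota 1 n) (3%:R^-1 : R) ^+ m = (1 - 3^-1 ^+ n) / 2.
  elim: n => [|n IHn]; first by rewrite big_nil subrr mul0r.
  have -> : iota 1 n.+1 = iota 1 n ++ [:: n.+1] by rewrite -[n.+1]addn1 iotaD add1n addn1.
  by rewrite big_cat IHn /= big_seq1 exprS; field.
apply: (@le_lt_trans _ _ (\sum_(m <- iota 1 M) 3%:R^-1 ^+ m)).
  by rewrite big_mkcond; apply: ler_sum => m _; case: ifP => // _; rewrite exprn_ge0.
have : 0 < (3^-1 : R) ^+ M by rewrite exprn_gt0.
rewrite geo; lra.
Qed.

(** Among reals at mutual distance at least [g], the geometric weights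
    [3 ^ (- D / g)] of those on one side of a reference point add up to less than
    [1 / 3 + 1 / 9 + ... = 1 / 2], because the integer parts of [D / g] are
    pairwise distinct. *)
Lemma sum_expR_side (R : realType) (t : nat) (D : 'I_t -> R) (g : R)
    (P : pred 'I_t) : 0 < g ->
  (forall l, P l -> g <= D l) ->
  (forall l m, P l -> P m -> l != m -> g <= `|D l - D m|) ->
  \sum_(l | P l) expR (- (D l * (ln 3 / g))) < 2^-1.
Proof.
move=> g0 Dg sep; pose n l := Num.truncn (D l / g).
have nP l : P l -> (n l)%:R <= D l / g < (n l).+1%:R.
  by move=> /Dg Pl; apply: truncn_itv; rewrite divr_ge0 ?ltW // (lt_le_trans g0).
apply: (@le_lt_trans _ _ (\sum_(m <- map n (enum P)) 3%:R^-1 ^+ m)).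
  rewrite big_map big_enum /=; apply: ler_sum => l Pl.
  have /andP[nl _] := nP _ Pl.
  have -> : (3%:R^-1 : R) ^+ n l = expR (- ((n l)%:R * ln 3)).
    by rewrite expRN expRM_natl lnK ?posrE // exprVn.
  have -> : D l * (ln 3 / g) = D l / g * ln 3 by ring.
  by rewrite ler_expR lerN2 ler_wpM2r // ln_ge0 // ler1n.
apply: sum_pow3_lt.
  rewrite map_inj_in_uniq ?enum_uniq // => l m.
  rewrite !mem_enum => Pl Pm nlm; apply/eqP/negPn/negP => lm.
  have := sep _ _ Pl Pm lm; apply/negP; rewrite -ltNge.
  rewrite -(ltr_pM2r (x := g^-1)) ?invr_gt0 // divff ?gt_eqF //.
  rewrite -[X in _ * X < _]gtr0_norm ?invr_gt0 // -normrM mulrBl.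
  have /andP[a1 a2] := nP _ Pl; have /andP[b1 b2] := nP _ Pm.
  rewrite nlm -natr1 in a1 a2; rewrite -natr1 in b2.
  by rewrite ltr_norml; apply/andP; split; lra.
apply/allP => x /mapP[l]; rewrite mem_enum => Pl ->.
by rewrite truncn_gt0 ler_pdivlMr // mul1r Dg.
Qed.

(** A term leading at both [s - h] and [s + h] leads at [s] by at least [h] times the
    distance of the exponents, so the weights at [s] decay geometrically on either
    side and [sum_expR_side] applies twice. *)
Lemma dominated_midpoint (R : realType) (t : nat) (b al : 'I_t -> R) (g s : R)
    (k : 'I_t) (h := ln 3 / g) : 0 < g ->
  (forall l m, l != m -> g <= `|al l - al m|) ->
  (forall l, b l + al l * (s - h) <= b k + al k * (s - h)) ->
  (forall l, b l + al l * (s + h) <= b k + al k * (s + h)) ->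
  \sum_(l | l != k) expR (b l + al l * s) < expR (b k + al k * s).
Proof.
move=> g0 sep hm hp.
have Dle l : expR (b l + al l * s) <=
    expR (b k + al k * s) * expR (- (`|al l - al k| * h)).
  rewrite -expRD ler_expR; have := hm l; have := hp l.
  by clearbody h; case: (ger0P (al l - al k)) => _; lra.
apply: (@le_lt_trans _ _ (expR (b k + al k * s) *
    \sum_(l | l != k) expR (- (`|al l - al k| * h)))).
  by rewrite mulr_sumr; apply: ler_sum.
rewrite gtr_pMr ?expR_gt0 // (bigID (fun l => al k < al l)) /=.
have right : \sum_(l | (l != k) && (al k < al l)) expR (- (`|al l - al k| * h)) < 2^-1.
  apply: (sum_expR_side (D := fun l => `|al l - al k|) g0) => [l /andP[lk _]|l m /andP[lk kl] /andP[mk km] lm].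
    exact: sep.
  rewrite -subr_gt0 in kl; rewrite -subr_gt0 in km.
  rewrite /= (gtr0_norm kl) (gtr0_norm km).
  have -> : al l - al k - (al m - al k) = al l - al m by ring.
  exact: sep.
have left : \sum_(l | (l != k) && ~~ (al k < al l)) expR (- (`|al l - al k| * h)) < 2^-1.
  apply: (sum_expR_side (D := fun l => `|al l - al k|) g0) => [l /andP[lk _]|l m /andP[lk kl] /andP[mk km] lm].
    exact: sep.
  rewrite -leNgt -subr_le0 in kl; rewrite -leNgt -subr_le0 in km.
  rewrite /= (ler0_norm kl) (ler0_norm km).
  have -> : - (al l - al k) - - (al m - al k) = al m - al l by ring.
  by apply: sep; rewrite eq_sym.
lra.
Qed.

(** Pigeonhole on the [t] points [0, 2 h, ..., 2 h (t - 1)]: a largest term can be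
    chosen at each of them among those of slope at least [al q], which leaves
    [p] out, so one term is the largest at two of these points, hence between
    them. *)
Lemma stable_leader (R : realType) (t : nat) (b al : 'I_t -> R) (h : R)
    (p q : 'I_t) : 0 < h -> al p < al q ->
  (forall l, b l <= b p) -> (forall l, b l <= b q) ->
  exists k s, [/\ 0 <= s <= 2 * h * t.-1%:R, al q <= al k,
    forall l, b l + al l * (s - h) <= b k + al k * (s - h) &
    forall l, b l + al l * (s + h) <= b k + al k * (s + h)].
Proof.
move=> h0 apq bp bq.
pose K (m : nat) := if m is 0%N then q
  else [arg max_(l > q) (b l + al l * (2 * h * m%:R))]%O.
have KP m l : b l + al l * (2 * h * m%:R) <= b (K m) + al (K m) * (2 * h * m%:R).
  case: m => [|m]; first by rewrite !mulr0 !addr0 /= bq.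
  by rewrite /K; case: arg_maxP => //= k _; exact.
have Kq m : al q <= al (K m).
  case: m => [|m]; first exact: lexx.
  have := KP m.+1 q; have := bq (K m.+1); set k := K _ => h1 h2.
  have m0 : 0 < 2 * h * m.+1%:R by rewrite !mulr_gt0 ?ltr0n.
  by rewrite -(ler_pM2r m0); lra.
have [m1 [m2 [m12 m2t Km]]] : exists m1 m2, [/\ (m1 < m2)%N, (m2 < t)%N & K m1 = K m2].
  apply: contrapT => hN; have inj : injective (fun m : 'I_t => K m).
    move=> x y xy; apply/val_inj => /=; case: (ltngtP x y) => // xlt; exfalso; apply: hN.
      by exists x, y; split.
    by exists y, x; split.
  have /codomP[x px] : p \in codom (fun m : 'I_t => K m) by exact: inj_card_onto.
  by have := Kq x; rewrite -px leNgt apq.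
exists (K m1), (2 * h * m1%:R + h).
have lin (l : 'I_t) x : 2 * h * m1%:R <= x <= 2 * h * m2%:R ->
    b l + al l * x <= b (K m1) + al (K m1) * x.
  move=> /andP[x1 x2]; have := KP m1 l; have := KP m2 l; rewrite -Km.
  move: (al l) (b l) (al (K m1)) (b (K m1)) => a0 b0 a1 b1 h2 h1.
  by have [aa|aa] := leP a0 a1; nra.
have S : 2 * h * m1%:R + h + h = 2 * h * m1.+1%:R by rewrite -natr1; ring.
have m12R : 2 * h * m1.+1%:R <= 2 * h * m2%:R.
  by rewrite ler_pM2l ?mulr_gt0 // ler_nat.
split=> [||l|l].
- rewrite addr_ge0 ?mulr_ge0 ?(ltW h0) //=.
  have : 2 * h * m2%:R <= 2 * h * t.-1%:R.
    by rewrite ler_pM2l ?mulr_gt0 // ler_nat; case: (t) m2t.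
  by move: m12R; rewrite -S; lra.
- exact: Kq.
- by rewrite addrK; apply: lin; move: m12R; rewrite -S; lra.
- by rewrite S; apply: lin; rewrite m12R andbT -S; lra.
Qed.

(** If two terms of a univariate sum with spectral gap [g] share the largest
    modulus at the origin, walking right leads to a point where a single term of
    larger exponent dominates, walking left to one where a term of smaller
    exponent does; [usum_strip_zero] applies in between. *)
Theorem usum_zero_near_kink (R : realType) (t : nat) (c : 'I_t -> R[i])
    (al : 'I_t -> R) (g : R) (p q : 'I_t) : 0 < g ->
  (forall l m, l != m -> g <= `|al l - al m|) ->
  (forall l, c l != 0) -> p != q ->
  (forall l, cmod (c l) <= cmod (c p)) -> (forall l, cmod (c l) <= cmod (c q)) ->
  exists2 s, `|Re s| <= 2 * (ln 3 / g) * t.-1%:R & usum c al s = 0.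
Proof.
move=> g0 sep c0; wlog apq : p q / al p < al q.
  move=> W pq; have := sep _ _ pq; have [|aqp|->] := ltgtP (al p) (al q).
  - by move=> a _; exact: W.
  - by move=> _ cp cq; apply: (W q p) => //; rewrite eq_sym.
  - by rewrite subrr normr0 leNgt g0.
move=> _ cp cq; pose b l := ln (cmod (c l)).
have bE l x : cmod (c l) * expR x = expR (b l + x).
  by rewrite expRD lnK // posrE cmod_gt0.
have ble l m : cmod (c l) <= cmod (c m) -> b l <= b m.
  by move=> lm; rewrite ler_ln ?posrE ?cmod_gt0.
have h0 : 0 < ln 3 / g by rewrite divr_gt0 // ln_gt0; lra.
have [k [s2 [s2b qk km kp]]] := stable_leader h0 apq
  (fun l => ble _ _ (cp l)) (fun l => ble _ _ (cq l)).
have apqN : - al q < - al p by rewrite ltrN2.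
have [j [s1 [s1b pj jm jp]]] := @stable_leader _ _ b (fun l => - al l) _ q p h0
  apqN (fun l => ble _ _ (cq l)) (fun l => ble _ _ (cp l)).
have [s /andP[a1 a2] z] : exists2 s, - s1 <= Re s <= s2 & usum c al s = 0.
  apply: (@usum_strip_zero _ _ c al (- s1) s2 j k); first lra.
  - by apply: le_lt_trans (lt_le_trans apq qk); rewrite -lerN2.
  - rewrite bE (eq_bigr _ (fun l _ => bE l _)).
    apply: (dominated_midpoint g0) => // l; [have := jp l|have := jm l]; lra.
  - rewrite bE (eq_bigr _ (fun l _ => bE l _)).
    exact: (dominated_midpoint g0).
by exists s => //; rewrite ler_norml; apply/andP; split; lra.
Qed.

(** * Euclidean geometry *)

Definition dotr (R : realType) (n : nat) (u v : 'rV[R]_n) : R :=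
  \sum_i u 0 i * v 0 i.

Lemma dotrC (R : realType) (n : nat) (u v : 'rV[R]_n) : dotr u v = dotr v u.
Proof. by apply: eq_bigr => i _; rewrite mulrC. Qed.

Lemma dotrDl (R : realType) (n : nat) (u v w : 'rV[R]_n) :
  dotr (u + v) w = dotr u w + dotr v w.
Proof. by rewrite -big_split; apply: eq_bigr => i _; rewrite mxE mulrDl. Qed.

Lemma dotrZl (R : realType) (n : nat) (x : R) (u v : 'rV[R]_n) :
  dotr (x *: u) v = x * dotr u v.
Proof. by rewrite mulr_sumr; apply: eq_bigr => i _; rewrite mxE mulrA. Qed.

Lemma dotrDr (R : realType) (n : nat) (u v w : 'rV[R]_n) :
  dotr w (u + v) = dotr w u + dotr w v.
Proof. by rewrite !(dotrC w) dotrDl. Qed.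

Lemma dotrZr (R : realType) (n : nat) (x : R) (u v : 'rV[R]_n) :
  dotr v (x *: u) = x * dotr v u.
Proof. by rewrite !(dotrC v) dotrZl. Qed.

Lemma dotrBl (R : realType) (n : nat) (u v w : 'rV[R]_n) :
  dotr (u - v) w = dotr u w - dotr v w.
Proof. by rewrite -scaleN1r dotrDl dotrZl mulN1r. Qed.

Lemma dotr_sumr (R : realType) (n : nat) (I : finType) (P : pred I)
    (F : I -> 'rV[R]_n) (w : 'rV[R]_n) :
  dotr w (\sum_(i | P i) F i) = \sum_(i | P i) dotr w (F i).
Proof.
apply: (big_morph (dotr w)) => [u v|]; first exact: dotrDr.
by rewrite /dotr big1 // => i _; rewrite mxE mulr0.
Qed.

Lemma dotr_ge0 (R : realType) (n : nat) (u : 'rV[R]_n) : 0 <= dotr u u.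
Proof. by apply: sumr_ge0 => i _; rewrite -expr2 sqr_ge0. Qed.

Lemma l2normE (R : realType) (n : nat) (u : 'rV[R]_n) :
  l2norm u = Num.sqrt (dotr u u).
Proof. by congr Num.sqrt; apply: eq_bigr => i _; rewrite expr2. Qed.

Lemma sqr_l2norm (R : realType) (n : nat) (u : 'rV[R]_n) :
  l2norm u ^+ 2 = dotr u u.
Proof. by rewrite l2normE sqr_sqrtr ?dotr_ge0. Qed.

Lemma l2norm_ge0 (R : realType) (n : nat) (u : 'rV[R]_n) : 0 <= l2norm u.
Proof. exact: sqrtr_ge0. Qed.

Lemma l2normZ (R : realType) (n : nat) (x : R) (u : 'rV[R]_n) :
  l2norm (x *: u) = `|x| * l2norm u.
Proof.
by rewrite !l2normE dotrZl dotrZr mulrA -expr2 sqrtrM ?sqr_ge0 // sqrtr_sqr.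
Qed.

Lemma l2norm_coord (R : realType) (n : nat) (u : 'rV[R]_n) (i : 'I_n) :
  `|u 0 i| <= l2norm u.
Proof.
rewrite -sqrtr_sqr ler_wsqrtr // (bigD1 i) //= lerDl sumr_ge0 // => j _.
exact: sqr_ge0.
Qed.

Lemma l2norm_gt0 (R : realType) (n : nat) (u : 'rV[R]_n) : u != 0 -> 0 < l2norm u.
Proof.
move=> u0; rewrite lt_neqAle l2norm_ge0 andbT eq_sym; apply: contra u0 => /eqP e.
apply/eqP/rowP => i; apply/eqP; rewrite mxE -normr_le0 -e; exact: l2norm_coord.
Qed.

Lemma cauchy_schwarz (R : realType) (n : nat) (u v : 'rV[R]_n) :
  `|dotr u v| <= l2norm u * l2norm v.
Proof.
have [->|v0] := eqVneq v 0.
  rewrite /dotr big1 ?normr0 ?mulr_ge0 ?l2norm_ge0 // => i _.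
  by rewrite mxE mulr0.
have V0 : 0 < dotr v v by rewrite -sqr_l2norm exprn_gt0 // l2norm_gt0.
rewrite -ler_sqr ?nnegrE ?mulr_ge0 ?l2norm_ge0 // exprMn !sqr_l2norm.
rewrite real_normK ?num_real //.
have := dotr_ge0 (dotr v v *: u + (- dotr u v) *: v).
rewrite !dotrDl !dotrDr !dotrZl !dotrZr (dotrC v u) => h.
rewrite -subr_ge0 -(pmulr_rge0 _ V0); lra.
Qed.

(** Bang's lemma: a signed sum of unit vectors of maximal length has, by comparison
    with the sums in which one sign is flipped, a scalar product of absolute value
    at least [1] with each of them. *)
Lemma bang (R : realType) (n : nat) (I : finType) (P : pred I)
    (v : I -> 'rV[R]_n) : (forall i, P i -> dotr (v i) (v i) = 1) ->
  exists2 x, l2norm x <= \sum_(i | P i) 1 &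
    forall i, P i -> 1 <= `|dotr x (v i)|.
Proof.
move=> v1; pose X (e : {ffun I -> bool}) := \sum_(i | P i) (-1) ^+ e i *: v i.
pose e := [arg max_(e > [ffun=> false]) dotr (X e) (X e)]%O.
have emax f : dotr (X f) (X f) <= dotr (X e) (X e).
  by rewrite /e; case: arg_maxP => //= k _; exact.
exists (X e) => [|i Pi].
  have h : l2norm (X e) ^+ 2 <= l2norm (X e) * \sum_(i | P i) 1.
    rewrite sqr_l2norm {2}/X dotr_sumr mulr_sumr; apply: ler_sum => i Pi.
    rewrite dotrZr; apply: le_trans (ler_norm _) _; rewrite normrM normrX normrN1.
    rewrite expr1n mul1r; apply: le_trans (cauchy_schwarz _ _) _.
    by rewrite [l2norm (v i)]l2normE v1 // sqrtr1.
  have [->|x0] := eqVneq (l2norm (X e)) 0; first exact: sumr_ge0.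
  have xp : 0 < l2norm (X e) by rewrite lt_neqAle eq_sym x0 l2norm_ge0.
  by move: h; rewrite expr2 ler_pM2l.
pose f := [ffun k => if k == i then ~~ e i else e k].
have Xf : X f = X e + (- 2 * (-1) ^+ e i) *: v i.
  rewrite /X !(bigD1 i Pi) /= ffunE eqxx addrAC -scalerDl; congr (_ *: _ + _).
    by case: (e i); rewrite /= ?expr0 ?expr1; ring.
  by apply: eq_bigr => k /andP[_ /negbTE ki]; rewrite ffunE ki.
have := emax f; rewrite Xf !dotrDl !dotrDr !dotrZl !dotrZr (dotrC (v i)) v1 //.
rewrite -[X in _ <= X -> _]addr0 -!addrA lerD2l => h.
have h1 : 1 <= (-1) ^+ e i * dotr (X e) (v i).
  by case: (e i) h; rewrite /= ?expr0 ?expr1; lra.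
apply: le_trans h1 _; apply: le_trans (ler_norm _) _.
by rewrite normrM normrX normrN1 expr1n mul1r.
Qed.

Lemma min_gap_spec (R : realType) (n t : nat) (a : 'I_t -> 'rV[R]_n) :
  (1 < t)%N -> injective a ->
  0 < min_gap a /\ forall p q, p != q -> min_gap a <= l2norm (a p - a q).
Proof.
move=> t1 ia; rewrite /min_gap; set m := (X in fine X).
have mle p q : p != q -> (m <= (l2norm (a p - a q))%:E)%E.
  by move=> pq; exact: (@bigmin_le_cond _ _ _ _ (p, q)).
have m0 : (0 < m)%E.
  apply: lt_bigmin; first exact: ltry.
  case=> p q /= pq; rewrite lte_fin l2norm_gt0 // subr_eq0.
  by apply: contra pq => /eqP/ia ->.
have mfin : m \is a fin_num.
  rewrite ge0_fin_numE ?ltW //.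
  apply: le_lt_trans (mle (Ordinal (ltnW t1)) (Ordinal t1) _) _ => //.
  exact: ltry.
split=> [|p q pq]; first by rewrite -lte_fin fineK.
by rewrite -lee_fin fineK // mle.
Qed.

(** Bang's lemma applied to the normalised differences of the spectrum gives a
    direction on which the spectrum projects without losing its gap; the
    bound on its length is the number of ordered pairs. *)
Lemma good_direction (R : realType) (n t : nat) (a : 'I_t -> 'rV[R]_n) :
  (1 < t)%N -> injective a ->
  exists2 x, l2norm x <= t%:R * t.-1%:R &
    forall p q, p != q -> min_gap a <= `|dotr (a p) x - dotr (a q) x|.
Proof.
move=> t1 ia; have [_ mle] := min_gap_spec t1 ia.
have nz p q : p != q -> 0 < l2norm (a p - a q).
  by move=> pq; rewrite l2norm_gt0 // subr_eq0; apply: contra pq => /eqP/ia ->.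
pose v (pq : 'I_t * 'I_t) := (l2norm (a pq.1 - a pq.2))^-1 *: (a pq.1 - a pq.2).
have [[p q] /= pq|x xle xge] := @bang _ _ _ (fun pq => pq.1 != pq.2) v.
  by rewrite dotrZl dotrZr -sqr_l2norm; field; rewrite gt_eqF ?nz.
exists x => [|p q pq].
  apply: le_trans xle _.
  rewrite -(pair_big_dep xpredT (fun p q => p != q) (fun _ _ => 1)) /=.
  rewrite (eq_bigr (fun=> t.-1%:R)) => [|p _].
    by rewrite sumr_const card_ord mulr_natl.
  rewrite sumr_const; congr (_ *+ _).
  by rewrite -[t in RHS]card_ord -(cardC1 p); apply: eq_card => q; rewrite !inE eq_sym.
have := xge (p, q) pq; rewrite /v /= dotrZr normrM normfV.
rewrite (ger0_norm (l2norm_ge0 _)) mulrC ler_pdivlMr ?nz // mul1r dotrC dotrBl.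
exact: le_trans (mle _ _ pq).
Qed.

(** * Zeros and tropical points of multivariate sums *)

Definition cvec (R : realType) (n : nat) (x y : 'rV[R]_n) : 'rV[R[i]]_n :=
  \row_i (x 0 i +i* y 0 i)%C.

Lemma re_vec_cvec (R : realType) (n : nat) (x y : 'rV[R]_n) :
  re_vec (cvec x y) = x.
Proof. by apply/rowP => i; rewrite !mxE. Qed.

Lemma cdot_cvec (R : realType) (n : nat) (a x y : 'rV[R]_n) :
  cdot a (cvec x y) = (dotr a x +i* dotr a y)%C.
Proof.
apply/eqP; rewrite eq_complex /cdot !raddf_sum; apply/andP; split; apply/eqP;
  by apply: eq_bigr => i _; rewrite mxE /= mul0r ?subr0 ?addr0.
Qed.

Lemma cvecE (R : realType) (n : nat) (z : 'rV[R[i]]_n) :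
  z = cvec (re_vec z) (map_mx (@Im R) z).
Proof. by apply/rowP => i; rewrite !mxE; case: (z 0 i). Qed.

(** The logarithm of the modulus of a term, see [cmod_expterm]. *)
Definition height (R : realType) (n t : nat) (a : 'I_t -> 'rV[R]_n)
    (beta : 'I_t -> R[i]) (u : 'rV[R]_n) (l : 'I_t) : R :=
  dotr (a l) u + Re (beta l).

Lemma cmod_expterm (R : realType) (n t : nat) (a : 'I_t -> 'rV[R]_n)
    (beta : 'I_t -> R[i]) (z : 'rV[R[i]]_n) (l : 'I_t) :
  cmod (expterm a beta z l) = expR (height a beta (re_vec z) l).
Proof. by rewrite cmod_cexp raddfD /= {1}[z]cvecE cdot_cvec. Qed.

Lemma TropP (R : realType) (n t : nat) (a : 'I_t -> 'rV[R]_n)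
    (beta : 'I_t -> R[i]) (u : 'rV[R]_n) :
  Trop a beta u <-> exists j k : 'I_t, [/\ j != k,
    forall l, height a beta u l <= height a beta u j &
    forall l, height a beta u l <= height a beta u k].
Proof.
have maxE z j : max_attained_at a beta z j <->
    forall l, height a beta (re_vec z) l <= height a beta (re_vec z) j.
  by split => h l; have := h l; rewrite !normr_cmod lecR !cmod_expterm ler_expR.
split=> [[z [j [k [jk /maxE hj /maxE hk]]] <-]|[j [k [jk hj hk]]]].
  by exists j, k.
exists (cvec u 0); last exact: re_vec_cvec.
by exists j, k; split=> //; apply/maxE; rewrite re_vec_cvec.
Qed.

Lemma dist_to_le (R : realType) (n : nat) (x y : 'rV[R]_n) (B : set 'rV[R]_n) (e : R) :
  B y -> l2norm (x - y) <= e -> (dist_to x B <= e%:E)%E.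
Proof.
move=> By xy; apply: (@le_trans _ _ (l2norm (x - y))%:E); last by rewrite lee_fin.
by apply: ereal_inf_lbound; exists y.
Qed.

(** At a zero no term outweighs the others together, so some modulus other than the
    largest is at least the largest over [t - 1]. Walking from [r] in the direction
    that favours this term most, the first tie of any term with the leader comes
    within [ln (t - 1)] over the distance of the two exponents. *)
Lemma zero_near_Trop (R : realType) (n t : nat) (a : 'I_t -> 'rV[R]_n)
    (beta : 'I_t -> R[i]) (r : 'rV[R]_n) :
  (1 < t)%N -> injective a -> ReZ a beta r ->
  exists2 u, Trop a beta u & l2norm (r - u) <= ln t.-1%:R / min_gap a.
Proof.
move=> t1 ia [z /= z0 zr]; have [m0 mle] := min_gap_spec t1 ia.
have t0 : (0 < t.-1)%N by rewrite -subn1 subn_gt0.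
pose Hr := height a beta r.
pose j := [arg max_(l > Ordinal t1) Hr l]%O.
have jmax l : Hr l <= Hr j by rewrite /j; case: arg_maxP => //= k _; exact.
have [k kj Hk] : exists2 k, k != j & Hr j - Hr k <= ln t.-1%:R.
  apply: contrapT => hN.
  have lt_j l : l != j -> expR (Hr l) < expR (Hr j) / t.-1%:R.
    move=> lj; rewrite -[t.-1%:R]lnK ?posrE ?ltr0n // -expRN -expRD ltr_expR ltNge; apply/negP => h.
    by apply: hN; exists l => //; lra.
  have : expR (Hr j) <= \sum_(l | l != j) expR (Hr l).
    have -> : expR (Hr j) = cmod (\sum_(l | l != j) expterm a beta z l).
      rewrite /Hr -zr -cmod_expterm; move: z0.
      rewrite /expsum (bigD1 j) // => /eqP; rewrite addr_eq0 => /eqP ->.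
      by rewrite normcN.
    apply: le_trans (ler_cmod_sum _ _) _; apply: ler_sum => l _.
    by rewrite cmod_expterm zr.
  apply/negP; rewrite -ltNge.
  have cardj : #|[pred l | l != j]| = t.-1 by rewrite cardC1 card_ord.
  have -> : expR (Hr j) = \sum_(l | l != j) expR (Hr j) / t.-1%:R.
    rewrite sumr_const cardj -[RHS]mulr_natr divfK // pnatr_eq0.
    by rewrite -lt0n.
  apply: ltr_sum => [|l]; last exact: lt_j.
  apply/hasP; exists (if j == Ordinal t1 then Ordinal (ltnW t1) else Ordinal t1).
    by rewrite mem_index_enum.
  by have [->|] := eqVneq j (Ordinal t1); rewrite // eq_sym.
pose w := a k - a j; pose e l := Hr j - Hr l; pose m l := dotr (a l - a j) w.
have e0 l : 0 <= e l by rewrite subr_ge0.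
have gap_jk : min_gap a <= l2norm w by exact: mle.
have w0 : 0 < l2norm w by exact: lt_le_trans gap_jk.
have mk : 0 < m k by rewrite /m -/w -sqr_l2norm exprn_gt0.
pose l0 := [arg min_(l < k | 0 < m l) (e l / m l)]%O.
have [ml0 l0min] : 0 < m l0 /\ forall l, 0 < m l -> e l0 / m l0 <= e l / m l.
  by rewrite /l0; case: arg_minP.
pose s := e l0 / m l0.
have s0 : 0 <= s by rewrite divr_ge0 // ltW.
have Hu l : height a beta (r + s *: w) l = Hr l + s * dotr (a l) w.
  by rewrite /height dotrDr dotrZr /Hr /height; ring.
have lej l : height a beta (r + s *: w) l <= height a beta (r + s *: w) j.
  rewrite !Hu; have : s * m l <= e l.
    have [ml|ml] := ltP 0 (m l); first by rewrite -ler_pdivlMr // l0min.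
    by apply: le_trans (e0 l); rewrite mulr_ge0_le0.
  by rewrite /m /e dotrBl; lra.
have tie : height a beta (r + s *: w) l0 = height a beta (r + s *: w) j.
  rewrite !Hu; have : s * m l0 = e l0 by rewrite /s divfK // gt_eqF.
  by rewrite /m /e dotrBl; lra.
exists (r + s *: w).
  apply/TropP; exists j, l0; split=> // [|l]; last by rewrite tie.
  apply: contraTneq ml0 => <-; rewrite /m dotrBl subrr ltxx //.
rewrite opprD addNKr -scaleNr l2normZ normrN ger0_norm //.
rewrite ler_pdivlMr //; apply: le_trans Hk.
have : s * m k <= e k by rewrite -ler_pdivlMr // l0min.
rewrite /m -/w -sqr_l2norm expr2 mulrA; apply: le_trans.
by rewrite ler_wpM2l // mulr_ge0 // l2norm_ge0.
Qed.

(** Restricting the sum to a complex line through [u] in a good direction turns the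
    tropical point [u] into a tie at the origin of a univariate sum. *)
Lemma Trop_near_zero (R : realType) (n t : nat) (a : 'I_t -> 'rV[R]_n)
    (beta : 'I_t -> R[i]) (u : 'rV[R]_n) :
  (1 < t)%N -> injective a -> Trop a beta u ->
  exists2 r, ReZ a beta r &
    l2norm (u - r) <= 2 * ln 3 * t.-1%:R * (t%:R * t.-1%:R) / min_gap a.
Proof.
move=> t1 ia /TropP[p [q [pq hp hq]]]; have [m0 _] := min_gap_spec t1 ia.
have [x xle xgap] := good_direction t1 ia.
pose c l := cexp ((dotr (a l) u)%:C%C + beta l).
have cE l : cmod (c l) = expR (height a beta u l) by rewrite cmod_cexp raddfD.
have [] := @usum_zero_near_kink R t c (fun l => dotr (a l) x) (min_gap a) p q m0.
- by move=> l m; exact: xgap.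
- by move=> l; rewrite -cmod_gt0 cE expR_gt0.
- exact: pq.
- by move=> l; rewrite !cE ler_expR.
- by move=> l; rewrite !cE ler_expR.
move=> s hs zs; exists (u + Re s *: x).
  exists (cvec (u + Re s *: x) (Im s *: x)); last exact: re_vec_cvec.
  rewrite /= -zs; apply: eq_bigr => l _; rewrite -cexpD; congr cexp.
  rewrite cdot_cvec !dotrDr !dotrZr; case: s {hs zs} => s1 s2 /=.
  by case: (beta l) => b1 b2; simpc; congr (_ +i* _)%C; ring.
rewrite opprD addNKr -scaleNr l2normZ normrN.
apply: le_trans (ler_pM _ _ hs xle) _; rewrite ?l2norm_ge0 //.
rewrite le_eqVlt; apply/orP; left; apply/eqP; field.
by rewrite gt_eqF.
Qed.

(** * Dimension of the spectrum *)

Lemma translate_inj (R : realType) (n : nat) (p q : 'rV[R]_n)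
    (U W : {vspace 'rV[R]_n}) : translate p U = translate q W -> U = W.
Proof.
have sub (p1 q1 : 'rV[R]_n) (U1 W1 : {vspace 'rV[R]_n}) :
    translate p1 U1 = translate q1 W1 -> (U1 <= W1)%VS.
  move=> E; apply/subvP => x xU.
  have [w0 /= w0W e0] : translate q1 W1 p1.
    by rewrite -E; exists 0; rewrite /= ?mem0v ?addr0.
  have [w1 /= w1W e1] : translate q1 W1 (p1 + x) by rewrite -E; exists x.
  have -> : x = w1 - w0 by apply: (addrI p1); rewrite -e1 -e0 -addrA [w0 + _]addrC subrK.
  exact: memvB.
by move=> E; apply/eqP; rewrite eqEsubv (sub _ _ _ _ E) (sub _ _ _ _ (esym E)).
Qed.

Definition differences (R : realType) (n t : nat) (a : 'I_t -> 'rV[R]_n)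
  (l0 : 'I_t) : seq 'rV[R]_n := [seq a l - a l0 | l <- enum (predC1 l0)].

Lemma affine_span_range (R : realType) (n t : nat) (a : 'I_t -> 'rV[R]_n)
    (l0 : 'I_t) :
  affine_span (range a) = translate (a l0) <<differences a l0>>%VS.
Proof.
have dU l : a l - a l0 \in <<differences a l0>>%VS.
  have [->|ll0] := eqVneq l l0; first by rewrite subrr mem0v.
  by apply: memv_span; apply: map_f; rewrite mem_enum.
apply/seteqP; split => x.
  apply; split; first by exists (a l0), <<differences a l0>>%VS.
  by move=> _ [l _ <-]; exists (a l - a l0) => /=; [exact: dU|rewrite addrC subrK].
move=> [u /= uU <-] _ [[p [W ->]] sub].
have [w0 /= w0W e0] : translate p W (a l0) by apply: sub; exists l0.
exists (w0 + u) => /=; last by rewrite addrA e0.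
apply: memvD => //; apply: subvP uU; apply/span_subvP => _ /mapP[l _ ->].
have [w1 /= w1W <-] : translate p W (a l) by apply: sub; exists l.
by rewrite -e0 opprD addrACA subrr add0r memvB.
Qed.

Lemma affine_dim_range (R : realType) (n t : nat) (a : 'I_t -> 'rV[R]_n)
    (l0 : 'I_t) :
  affine_dim (affine_span (range a)) = \dim <<differences a l0>>.
Proof.
rewrite (affine_span_range a l0) /affine_dim; set P := [set d | _].
have : P (xget 0%N P).
  apply: xgetPex; exists (\dim <<differences a l0>>).
  by exists (a l0), <<differences a l0>>%VS.
by case=> p [U [/translate_inj -> ->]].
Qed.

Lemma size_differences (R : realType) (n t : nat) (a : 'I_t -> 'rV[R]_n)
  (l0 : 'I_t) : size (differences a l0) = t.-1.
Proof. by rewrite size_map -cardE cardC1 card_ord. Qed.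

Lemma affine_dim_le (R : realType) (n t : nat) (a : 'I_t -> 'rV[R]_n) :
  (0 < t)%N -> (affine_dim (affine_span (range a)) <= minn n t.-1)%N.
Proof.
move=> t0; rewrite (affine_dim_range a (Ordinal t0)) leq_min; apply/andP; split.
  by apply: leq_trans (dimvS (subvf _)) _; rewrite dimvf /dim /= mul1n.
by apply: leq_trans (dim_span _) _; rewrite size_differences.
Qed.

Lemma affine_dim_gt0 (R : realType) (n t : nat) (a : 'I_t -> 'rV[R]_n) :
  (1 < t)%N -> injective a -> (0 < affine_dim (affine_span (range a)))%N.
Proof.
move=> t1 ia; rewrite (affine_dim_range a (Ordinal (ltnW t1))) lt0n dimv_eq0.
apply/eqP => U0; have : a (Ordinal t1) - a (Ordinal (ltnW t1)) \in (0%VS : {vspace _}).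
  by rewrite -U0; apply: memv_span; apply: map_f; rewrite mem_enum.
by rewrite memv0 subr_eq0 => /eqP/ia.
Qed.

(** * Affinely independent spectra *)

Lemma linear_dotr (R : realType) (n : nat) (f : {linear 'rV[R]_n -> R^o}) :
  exists y, forall x, f x = dotr x y.
Proof.
exists (\row_i f (delta_mx 0 i)) => x.
rewrite {1}[x]row_sum_delta linear_sum; apply: eq_bigr => i _.
by rewrite linearZ mxE.
Qed.

Lemma solve_phases (R : realType) (n t : nat) (a : 'I_t -> 'rV[R]_n) (l0 : 'I_t)
    (w : 'I_t -> R) : t = (affine_dim (affine_span (range a))).+1 ->
  exists y, forall l, l != l0 -> dotr (a l - a l0) y = w l.
Proof.
move=> td; have fr : free (differences a l0).
  rewrite /free -(affine_dim_range a) size_differences; apply/eqP.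
  exact: esym (congr1 predn td).
have [f fP] := @linear_of_free R 'rV[R]_n R^o (differences a l0)
  [seq (w l : R^o) | l <- enum (predC1 l0)].
have [y yP] := linear_dotr f; exists y => l ll0; rewrite -yP.
have := fP fr; rewrite /differences !size_map -map_comp => /(_ erefl).
by move=> /eq_in_map/(_ l) /=; apply; rewrite mem_enum.
Qed.

(** Adding each length against the sign of the running total never lets the total
    leave [[- M, M]]. *)
Lemma greedy_signs (R : realType) (I : eqType) (rho : I -> R) (M : R) (s : seq I) :
  uniq s -> 0 <= M -> (forall l, 0 <= rho l <= M) ->
  exists phi : I -> R, (forall l, sin (phi l) = 0) /\
    `|\sum_(l <- s) rho l * cos (phi l)| <= M.
Proof.
move=> us M0 rM; elim: s us => [_|x s IH] /=.
  by exists (fun=> 0); split => [l|]; rewrite ?sin0 // big_nil normr0.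
case/andP=> xs /IH[phi [phi0 phiM]]; set S := \sum_(l <- s) _ in phiM.
exists (fun l => if l == x then (if 0 <= S then pi else 0) else phi l); split=> [l|].
  by case: ifP => // _; case: ifP; rewrite ?sinpi ?sin0.
rewrite big_cons eqxx (_ : \sum_(l <- s) _ = S); last first.
  apply: eq_big_seq => l ls; case: eqVneq => // lx.
  by rewrite -lx ls in xs.
have /andP[r0 r1] := rM x; move: phiM; rewrite !ler_norml => /andP[p1 p2].
have [S0|S0] := leP 0 S; rewrite ?cospi ?cos0; apply/andP; split; lra.
Qed.

(** A closed polygon with prescribed side lengths exists when the two longest sides
    are equal: fold the other sides along a line, then close up with an isosceles
    triangle. *)
Lemma closed_polygon (R : realType) (I : finType) (rho : I -> R) (p q : I) :
  p != q -> 0 < rho p -> rho p = rho q -> (forall l, 0 <= rho l <= rho p) ->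
  exists phi : I -> R, \sum_l rho l * cos (phi l) = 0 /\
    \sum_l rho l * sin (phi l) = 0.
Proof.
move=> pq p0 epq rM; pose s := [seq l <- index_enum I | (l != p) && (l != q)].
have [phi [phi0 phiM]] : exists phi : I -> R, (forall l, sin (phi l) = 0) /\
    `|\sum_(l <- s) rho l * cos (phi l)| <= rho p.
  by apply: greedy_signs => //; [rewrite filter_uniq // index_enum_uniq|exact: ltW].
set S := \sum_(l <- s) _ in phiM.
have x1 : -1 <= - S / (2 * rho p) <= 1.
  move: phiM; rewrite ler_norml => /andP[a b].
  rewrite ler_pdivlMr ?ler_pdivrMr ?mulr_gt0 //; apply/andP; split; lra.
pose psi := acos (- S / (2 * rho p)).
exists (fun l => if l == p then psi else if l == q then - psi else phi l).
have split_sum (f : R -> R) :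
    \sum_l rho l * f (if l == p then psi else if l == q then - psi else phi l) =
    rho p * (f psi + f (- psi)) + \sum_(l <- s) rho l * f (phi l).
  rewrite (bigD1 p) // (bigD1 q) 1?eq_sym //= eqxx eq_sym (negbTE pq) eqxx -epq.
  rewrite addrA -mulrDr; congr (_ + _); rewrite big_filter; apply: eq_bigr => l.
  by move=> /andP[/negbTE -> /negbTE ->].
split; rewrite split_sum.
  by rewrite cosN /psi acosK ?in_itv // -/S; field; rewrite gt_eqF.
by rewrite sinN subrr mulr0 add0r big1 // => l _; rewrite phi0 mulr0.
Qed.

(** The phases produced by [closed_polygon] are realised up to a common rotation
    [th], which does not affect the vanishing of the sum. *)
Lemma simplex_Trop_sub_ReZ (R : realType) (n t : nat) (a : 'I_t -> 'rV[R]_n)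
    (beta : 'I_t -> R[i]) : t = (affine_dim (affine_span (range a))).+1 ->
  Trop a beta `<=` ReZ a beta.
Proof.
move=> td u /TropP[p [q [pq hp hq]]].
pose rho l := expR (height a beta u l).
have epq : rho p = rho q by congr expR; apply/eqP; rewrite eq_le hp hq.
have [phi [C0 S0]] : exists phi : 'I_t -> R, \sum_l rho l * cos (phi l) = 0 /\
    \sum_l rho l * sin (phi l) = 0.
  apply: (@closed_polygon _ _ rho p q) => // [|l]; first exact: expR_gt0.
  by rewrite expR_ge0 ler_expR hp.
have [y yP] := @solve_phases _ _ _ a p
  (fun l => phi l - phi p - Im (beta l) + Im (beta p)) td.
pose th := dotr (a p) y + Im (beta p) - phi p.
have phase l : dotr (a l) y + Im (beta l) = phi l + th.
  have [->|lp] := eqVneq l p; first by rewrite /th; ring.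
  by have := yP l lp; rewrite dotrBl /th; lra.
exists (cvec u y); last exact: re_vec_cvec.
rewrite /= /expsum (eq_bigr (fun l => cexp (0 +i* th)%C *
    (rho l * cos (phi l) +i* (rho l * sin (phi l)))%C)) => [|l _].
  rewrite -mulr_sumr; set z := \sum_l _; suff -> : z = 0 by rewrite mulr0.
  by apply/eqP; rewrite eq_complex /z !raddf_sum /= C0 S0 eqxx.
rewrite /expterm cdot_cvec.
have -> : ((dotr (a l) u +i* dotr (a l) y) + beta l)%C =
    ((0 +i* th) + (height a beta u l +i* phi l))%C.
  rewrite /height; case: (beta l) (phase l) => b1 b2 /= ph; simpc.
  by rewrite ph [th + _]addrC.
by rewrite cexpD; congr (_ * _); rewrite /cexp /=; simpc.
Qed.

(** * The extremal example *)

Lemma height_phi (R : realType) (t : nat) (delta : R) (u : 'rV[R]_t.-1) (l : 'I_t) :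
  height (phi_spectrum delta) (@phi_beta R t) u l =
  \sum_(i < t.-1) (if l == i.+1 :> nat then delta * u 0 i else 0).
Proof.
rewrite /height /phi_beta /= addr0; apply: eq_bigr => i _; rewrite mxE.
by case: ifP => // _; rewrite mul0r.
Qed.

Lemma height_phi0 (R : realType) (t : nat) (delta : R) (u : 'rV[R]_t.-1) (l : 'I_t) :
  l = 0%N :> nat -> height (phi_spectrum delta) (@phi_beta R t) u l = 0.
Proof. by move=> l0; rewrite height_phi big1 // => i _; rewrite l0. Qed.

Lemma height_phiS (R : realType) (t : nat) (delta : R) (u : 'rV[R]_t.-1) (l : 'I_t)
    (i : 'I_t.-1) : l = i.+1 :> nat ->
  height (phi_spectrum delta) (@phi_beta R t) u l = delta * u 0 i.
Proof.
move=> li; rewrite height_phi (bigD1 i) //= li eqxx big1 ?addr0 // => m mi.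
by rewrite eqSS val_eqE eq_sym (negbTE mi).
Qed.

Lemma phi_zero (R : realType) (t : nat) (delta : R) : (1 < t)%N -> 0 < delta ->
  ReZ (phi_spectrum delta) (@phi_beta R t) (const_mx (- (ln t.-1%:R / delta))).
Proof.
move=> t1 d0; have t0 : 0 < t.-1%:R :> R by rewrite ltr0n -subn1 subn_gt0.
exists (cvec (const_mx (- (ln t.-1%:R / delta))) (const_mx (pi / delta)));
  last exact: re_vec_cvec.
rewrite /= expsum_phi ?(ltnW t1) //.
rewrite (eq_bigr (fun=> - (t.-1%:R^-1)%:C%C)) => [|i _].
  rewrite sumr_const card_ord -[X in 1 + X]mulr_natr mulNr -(rmorph_nat (real_complex R)).
  by rewrite -rmorphM mulVf ?gt_eqF // rmorph1 subrr.
rewrite !mxE.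
have -> : (delta%:C * (- (ln t.-1%:R / delta) +i* (pi / delta)))%C =
    (- ln t.-1%:R +i* pi)%C.
  by simpc; congr (_ +i* _)%C; field; rewrite gt_eqF.
by rewrite /cexp /= cospi sinpi expRN lnK ?posrE //; simpc.
Qed.

Lemma phi_dist (R : realType) (t : nat) (delta : R) : (1 < t)%N -> 0 < delta ->
  dist_to (const_mx (- (ln t.-1%:R / delta)))
    (Trop (phi_spectrum delta) (@phi_beta R t)) = (ln t.-1%:R / delta)%:E.
Proof.
move=> t1 d0; have t0 : (0 < t.-1)%N by rewrite -subn1 subn_gt0.
set L := ln t.-1%:R / delta.
have L0 : 0 <= L by rewrite divr_ge0 ?ln_ge0 ?ler1n // ltW.
pose o : 'I_t := Ordinal (ltnW t1); pose o1 : 'I_t := Ordinal t1.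
apply/eqP; rewrite eq_le; apply/andP; split.
  pose u : 'rV[R]_t.-1 := \row_i (if i == 0%N :> nat then 0 else - L).
  have hu l : height (phi_spectrum delta) (@phi_beta R t) u l <= 0.
    have [l0|l0] := posnP l; first by rewrite height_phi0.
    have lt : (l.-1 < t.-1)%N by rewrite -ltnS !prednK // ltnW.
    rewrite (@height_phiS _ _ _ _ _ (Ordinal lt)) /= ?prednK // mxE.
    by case: ifP => _; rewrite ?mulr0 // mulrN oppr_le0 mulr_ge0 // ltW.
  have h0 : height (phi_spectrum delta) (@phi_beta R t) u o = 0.
    exact: height_phi0.
  have h1 : height (phi_spectrum delta) (@phi_beta R t) u o1 = 0.
    by rewrite (@height_phiS _ _ _ _ _ (Ordinal t0)) // mxE /= mulr0.
  apply: (@dist_to_le _ _ _ u).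
    by apply/TropP; exists o, o1; split => // l; rewrite ?h0 ?h1.
  rewrite -[leRHS](ger0_norm L0) -sqrtr_sqr ler_wsqrtr // (bigD1 (Ordinal t0)) //=.
  rewrite !mxE /= subr0 sqrrN big1 ?addr0 // => i i0; rewrite !mxE.
  by rewrite -val_eqE /= in i0; rewrite (negbTE i0) subrr expr0n.
apply/ereal_infP => _ [u /TropP[j [k [jk hj hk]]] <-]; rewrite lee_fin.
have [l l0 hl] : exists2 l : 'I_t, (0 < l)%N &
    forall m, height (phi_spectrum delta) (@phi_beta R t) u m <=
              height (phi_spectrum delta) (@phi_beta R t) u l.
  have [j0|] := posnP j; last by exists j.
  exists k => //; rewrite lt0n; apply: contra jk => /eqP k0.
  by apply/eqP/val_inj; rewrite /= j0 k0.
have lt : (l.-1 < t.-1)%N by rewrite -ltnS !prednK // ltnW.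
have := hl o; rewrite (height_phi0 _ _ (l := o)) //.
rewrite (@height_phiS _ _ _ _ _ (Ordinal lt)) /= ?prednK // pmulr_rge0 // => u0.
apply: le_trans (l2norm_coord _ (Ordinal lt)); rewrite !mxE.
by rewrite ler0_norm; lra.
Qed.

(** * Comparison of constants and conclusion *)

(** The constant obtained from [Trop_near_zero] is below the stated one because
    [ln (81 / 2) <= 2 * ln 9], [4 / 3 <= sqrt (e * d)] and
    [(t - 1) ^ 2 <= 4 / 3 * t * (t - 2)]. *)
Lemma constant_le (R : realType) (t d : nat) : (3 <= t)%N -> (0 < d)%N ->
  2 * ln 3 * t.-1%:R * (t%:R * t.-1%:R) <=
  Num.sqrt (expR 1 * d%:R) * t%:R ^+ 2 * (ln 9 * t%:R - ln (81 / 2)) :> R.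
Proof.
move=> t3 d0; have tR : 3 <= t%:R :> R by rewrite ler_nat.
have -> : t.-1%:R = t%:R - 1 :> R by rewrite -subn1 natrB // (leq_trans _ t3).
have l3 : 0 < ln 3 :> R by rewrite ln_gt0 // ltr1n.
have l9 : ln 9 = 2 * ln 3 :> R.
  by rewrite (_ : 9 = 3 * 3 :> R) ?lnM ?posrE //; ring.
have l81 : ln (81 / 2) <= 4 * ln 3 :> R.
  have -> : 4 * ln 3 = ln 81 :> R.
    rewrite (_ : 81 = 9 * 9 :> R) ?lnM ?posrE // ?l9; ring.
  by rewrite ler_ln ?posrE ?divr_gt0 //; lra.
have sq : 4 / 3 <= Num.sqrt (expR 1 * d%:R) :> R.
  rewrite -[4 / 3]ger0_norm; last lra.
  rewrite -sqrtr_sqr ler_wsqrtr //.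
  have e2 : 2 <= expR 1 :> R by have := @expR_ge1Dx R 1; lra.
  have dR : 1 <= d%:R :> R by rewrite ler1n.
  nra.
rewrite l9; set T := t%:R; set s := Num.sqrt _ in sq *.
have h1 : 2 * ln 3 * (T - 2) <= 2 * ln 3 * T - ln (81 / 2) by lra.
apply: (@le_trans _ _ (s * T ^+ 2 * (2 * ln 3 * (T - 2)))); last first.
  by rewrite ler_wpM2l // mulr_ge0 ?sqrtr_ge0 ?sqr_ge0.
have h2 : (T - 1) ^+ 2 <= s * (T * (T - 2)).
  apply: (@le_trans _ _ (4 / 3 * (T * (T - 2)))); first by nra.
  by rewrite ler_wpM2r // mulr_ge0; lra.
have -> : 2 * ln 3 * (T - 1) * (T * (T - 1)) = (2 * ln 3 * T) * (T - 1) ^+ 2 by ring.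
have -> : s * T ^+ 2 * (2 * ln 3 * (T - 2)) = (2 * ln 3 * T) * (s * (T * (T - 2))) by ring.
by rewrite ler_wpM2l // !mulr_ge0 //; lra.
Qed.

Theorem theorem1p10 (R : realType) (t : nat) (ht : (3 <= t)%N) :
  (forall (n : nat) (a : 'I_t -> 'rV[R]_n) (beta : 'I_t -> R[i]),
    injective a ->
    let d := affine_dim (affine_span (range a)) in
    [/\ (d <= minn n t.-1)%N,
        t = d.+1 -> Trop a beta `<=` ReZ a beta &
        (d.+1 <= t)%N ->
          (excess (ReZ a beta) (Trop a beta)
             <= (ln (t.-1)%:R / min_gap a)%:E)%E /\
          (excess (Trop a beta) (ReZ a beta)
             <= (Num.sqrt (expR 1 * d%:R) * t%:R ^+ 2
                   * (ln 9 * t%:R - ln (81 / 2)) / min_gap a)%:E)%E]) /\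
  (forall delta : R, 0 < delta ->
    let phi := phi_spectrum delta in
    let r : 'rV[R]_t.-1 := const_mx (- (ln (t.-1)%:R / delta)) in
    ReZ phi (@phi_beta R t) r /\
    dist_to r (Trop phi (@phi_beta R t)) = (ln (t.-1)%:R / delta)%:E).
Proof.
have t1 : (1 < t)%N by exact: leq_trans ht.
split=> [n a beta ia d|delta d0 phi r]; last first.
  by split; [exact: phi_zero|exact: phi_dist].
have [m0 _] := min_gap_spec t1 ia.
split; [by apply: affine_dim_le; exact: ltnW|exact: simplex_Trop_sub_ReZ|move=> _].
split; apply: ge_ereal_sup => _ [x xA <-].
  by have [u uT xu] := zero_near_Trop t1 ia xA; exact: dist_to_le xu.
have [u uZ xu] := Trop_near_zero t1 ia xA; apply: dist_to_le uZ _.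
apply: le_trans xu _; rewrite ler_pM2r ?invr_gt0 //.
by apply: constant_le => //; exact: affine_dim_gt0.
Qed.
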